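(* Let $(M^n,g,v^m\,\mathrm{dvol}_g)$ be a smooth metric measure space and let $u\in C^\infty(M)$ be a positive function. Let $(M^n,\hat g,\hat v^m\,\mathrm{dvol}_{\hat g})$ be the conformally equivalent smooth metric measure space with the same dimensional parameter $m$ and $$(M^n,\hat g,\hat v^m\,\mathrm{dvol}_{\hat g})=(M^n,u^{-2}g,u^{-m-n}v^m\,\mathrm{dvol}_g)$$ (so $\hat v=v/u$). Denote its Bakry-Émery Ricci tensor by $\mathrm{Ric}_{f,\phi}^m$ and its weighted scalar curvature by $u^2R_{f,\phi}^m$. Then $$\mathrm{Ric}_{f,\phi}^m=\mathrm{Ric}_\phi^m+(m+n-2)u^{-1}\nabla^2u+\left(u^{-1}\Delta_\phi u-(m+n-1)u^{-2}|\nabla u|^2\right)g,$$ $$R_{f,\phi}^m=R_\phi^m+2(m+n-1)u^{-1}\Delta_\phi u-(m+n)(m+n-1)u^{-2}|\nabla u|^2,$$ where all derivatives and norms on the right-hand sides are taken with respect to $g$.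
   Context: A smooth metric measure space (SMMS) is a four-tuple $(M^n,g,v^m\,\mathrm{dvol}_g,m)$ of a Riemannian manifold $(M^n,g)$, a positive function $v\in C^\infty(M)$ and $m\in\mathbb{R}\cup\{\pm\infty\}$; equivalently $(M^n,g,e^{-\phi}\mathrm{dvol}_g,m)$ with $\phi\in C^\infty(M)$, where $v^m=e^{-\phi}$ for finite $m$; when $|m|=\infty$ one only specifies $\phi$. If $m=0$, the measure is $\mathrm{dvol}_g$, $\phi=0$ and terms containing $\frac1m$ are read as $0$. Definitions: $\mathrm{Ric}_\phi^m=\mathrm{Ric}+\nabla^2\phi-\frac1m d\phi\otimes d\phi$ (which equals $\mathrm{Ric}-mv^{-1}\nabla^2v$ for finite $m$); $R_\phi^m=R+2\Delta\phi-\frac{m+1}{m}|\nabla\phi|^2$; $\Delta_\phi w=\Delta w-\langle\nabla\phi,\nabla w\rangle$. The curvatures of $(M,\hat g,\hat v^m\mathrm{dvol}_{\hat g})$ are defined by the same formulas with $(g,v)$ replaced by $(\hat g,\hat v)$. Convention for $|m|=\infty$: the conformal factor is encoded by the function $f$ with $u^{m+n-2}=e^f$, the conformal transformation is $(M,g,e^{-\phi}\mathrm{dvol}_g)\mapsto(M,g,e^{-f-\phi}\mathrm{dvol}_g)$, and the formulas are read as their limits for $u=e^{f/(m+n-2)}$, i.e. $\mathrm{Ric}_{f,\phi}^{\infty}=\mathrm{Ric}_\phi^\infty+\nabla^2f$ and $R_{f,\phi}^\infty=R_\phi^\infty+2\Delta_\phi f-|\nabla f|^2$. *)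

(* Defs.v *)
From HB Require Import structures.
From mathcomp Require Import all_boot all_order all_algebra.
From mathcomp Require Import all_classical all_reals all_analysis.
Set Implicit Arguments.
Unset Strict Implicit.
Unset Printing Implicit Defensive.
Import Order.TTheory GRing.Theory Num.Theory.
Import numFieldNormedType.Exports.
Local Open Scope classical_set_scope.
Local Open Scope ring_scope.

(** * Smooth functions on open subsets of R^n *)

Section Euclidean.
Variables (R : realType) (n : nat).

Definition partial (i : 'I_n) (f : 'rV[R]_n -> R) (x : 'rV[R]_n) : R :=
  'D_(delta_mx 0 i : 'rV[R]_n) f x.

(* Meant for open A. *)
Fixpoint Ck_on (k : nat) (A : set 'rV[R]_n) (f : 'rV[R]_n -> R) : Prop :=
  (forall x, A x -> {for x, continuous f}) /\
  (if k is k'.+1 then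
     forall i : 'I_n,
       (forall x, A x -> derivable f x (delta_mx 0 i : 'rV[R]_n)) /\
       Ck_on k' A (partial i f)
   else True).

Definition smooth_on (A : set 'rV[R]_n) (f : 'rV[R]_n -> R) : Prop :=
  forall k, Ck_on k A f.

End Euclidean.

(** * Smooth manifolds *)

(* [cinv] is the inverse of [cmap] on the image of [cdom]; the values of [cmap]
   outside [cdom] and of [cinv] outside that image are irrelevant. *)
Record chart (R : realType) (n : nat) (M : topologicalType) := Chart {
  cdom : set M;
  cmap : M -> 'rV[R]_n;
  cinv : 'rV[R]_n -> M;
  cdom_open : open cdom;
  ccod_open : open (cmap @` cdom);
  cmapK : forall p, cdom p -> cinv (cmap p) = p;
  cmap_continuous : forall p, cdom p -> {for p, continuous cmap};
  cinv_continuous : forall x, (cmap @` cdom) x -> {for x, continuous cinv}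
}.

Definition ccod R n M (c : @chart R n M) : set 'rV[R]_n := cmap c @` cdom c.

Definition transition R n M (c d : @chart R n M) (x : 'rV[R]_n) : 'rV[R]_n :=
  cmap d (cinv c x).

Definition overlap R n M (c d : @chart R n M) : set 'rV[R]_n :=
  cmap c @` (cdom c `&` cdom d).

Record manifold (R : realType) (n : nat) := Manifold {
  points :> topologicalType;
  points_hausdorff : hausdorff_space points;
  points_second_countable : @second_countable points;
  atlas_index : Type;
  atlas : atlas_index -> chart R n points;
  atlas_cover : forall p : points, exists c, cdom (atlas c) p;
  atlas_compat : forall (c d : atlas_index) (i : 'I_n),
    smooth_on (overlap (atlas c) (atlas d))
              (fun x => transition (atlas c) (atlas d) x 0 i)
}.

Definition in_chart R n (M : manifold R n) (c : atlas_index M) (w : M -> R) :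
  'rV[R]_n -> R := fun x => w (cinv (atlas c) x).

Definition smooth_fun R n (M : manifold R n) (w : M -> R) : Prop :=
  forall c, smooth_on (ccod (atlas c)) (in_chart c w).

(* A metric is given by its components g_ij in every chart of the atlas,
   subject to the transformation law of covariant 2-tensors. *)
Record riemannian_metric (R : realType) (n : nat) (M : manifold R n) :=
  RiemannianMetric {
  gcomp : atlas_index M -> 'rV[R]_n -> 'M[R]_n;
  gcomp_smooth : forall c i j,
    smooth_on (ccod (atlas c)) (fun x => gcomp c x i j);
  gcomp_sym : forall c x, ccod (atlas c) x -> (gcomp c x)^T = gcomp c x;
  gcomp_posdef : forall c x, ccod (atlas c) x ->
    forall v : 'rV[R]_n, v != 0 -> 0 < (v *m gcomp c x *m v^T) 0 0;
  gcomp_change : forall c d x, overlap (atlas c) (atlas d) x ->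
    forall i j, gcomp c x i j =
      \sum_k \sum_l
        partial i (fun y => transition (atlas c) (atlas d) y 0 k) x *
        partial j (fun y => transition (atlas c) (atlas d) y 0 l) x *
        gcomp d (transition (atlas c) (atlas d) x) k l
}.

(** * Riemannian geometry in local coordinates

    [g] is the matrix of components of the metric, [w], [phi], [psi] are
    functions, all read in one chart. *)

Section LocalFormulas.
Variables (R : realType) (n : nat).
Implicit Types (g : 'rV[R]_n -> 'M[R]_n) (w phi psi : 'rV[R]_n -> R).

(* Gamma^k_ij *)
Definition christoffel g (k i j : 'I_n) (x : 'rV[R]_n) : R :=
  2^-1 * \sum_l invmx (g x) k l *
    (partial i (fun y => g y j l) x + partial j (fun y => g y i l) x
     - partial l (fun y => g y i j) x).

(* the component along d_l of
   (nabla_i nabla_j - nabla_j nabla_i) d_k *)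
Definition riemann g (l k i j : 'I_n) (x : 'rV[R]_n) : R :=
  partial i (christoffel g l j k) x - partial j (christoffel g l i k) x
  + \sum_p (christoffel g l i p x * christoffel g p j k x
            - christoffel g l j p x * christoffel g p i k x).

(* Ric_kj = R^i_kij, positive on round spheres *)
Definition ricci g (x : 'rV[R]_n) : 'M[R]_n :=
  \matrix_(k, j) \sum_i riemann g i k i j x.

Definition gtrace g (T : 'M[R]_n) (x : 'rV[R]_n) : R :=
  \sum_i \sum_j invmx (g x) i j * T i j.

Definition scalar_curv g (x : 'rV[R]_n) : R := gtrace g (ricci g x) x.

Definition dtensor phi psi (x : 'rV[R]_n) : 'M[R]_n :=
  \matrix_(i, j) (partial i phi x * partial j psi x).

(* <grad phi, grad psi>_g *)
Definition gdot g phi psi (x : 'rV[R]_n) : R := gtrace g (dtensor phi psi x) x.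

Definition hessian g w (x : 'rV[R]_n) : 'M[R]_n :=
  \matrix_(i, j) (partial i (partial j w) x
                  - \sum_k christoffel g k i j x * partial k w x).

Definition laplacian g w (x : 'rV[R]_n) : R := gtrace g (hessian g w x) x.

End LocalFormulas.

(** * Smooth metric measure spaces *)

(* The measure is e^{-phi} dvol, which is v^m dvol when m is finite; in
   particular phi = 0 when m = 0.  For infinite m the field [vfun] carries no
   information. *)
Record smms (R : realType) (n : nat) (M : manifold R n) := SMMS {
  metric : riemannian_metric M;
  dimpar : \bar R;
  vfun : M -> R;
  phi : M -> R;
  vfun_smooth : smooth_fun vfun;
  vfun_gt0 : forall p, 0 < vfun p;
  phi_smooth : smooth_fun phi;
  vfun_phi : forall m : R, dimpar = m%:E ->
    forall p, vfun p `^ m = expR (- phi p)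
}.

Section SMMSTheory.
Variables (R : realType) (n : nat) (M : manifold R n) (S : smms M).
Implicit Types (c : atlas_index M) (w : M -> R) (x : 'rV[R]_n).

Definition scomp c : 'rV[R]_n -> 'M[R]_n := gcomp (metric S) c.

Definition phi_in c : 'rV[R]_n -> R := in_chart c (phi S).

(* 1/m, with 1/m = 0 both for m = 0 and for infinite m *)
Definition dim_inv : R := if dimpar S is r%:E then r^-1 else 0.

(* density of the measure e^{-phi} dvol_g with respect to the Lebesgue measure
   of the coordinates *)
Definition weighted_density c x : R :=
  expR (- phi_in c x) * Num.sqrt `|\det (scomp c x)|.

(* Ric + Hess phi - (1/m) dphi (x) dphi *)
Definition wricci c x : 'M[R]_n :=
  ricci (scomp c) x + hessian (scomp c) (phi_in c) x
  - dim_inv *: dtensor (phi_in c) (phi_in c) x.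

(* (m + 1)/m is written 1 + 1/m to cover infinite m *)
Definition wscalar c x : R :=
  scalar_curv (scomp c) x + 2 * laplacian (scomp c) (phi_in c) x
  - (1 + dim_inv) * gdot (scomp c) (phi_in c) (phi_in c) x.

Definition hess w c x : 'M[R]_n := hessian (scomp c) (in_chart c w) x.

Definition sqnorm_grad w c x : R :=
  gdot (scomp c) (in_chart c w) (in_chart c w) x.

Definition wlaplacian w c x : R :=
  laplacian (scomp c) (in_chart c w) x
  - gdot (scomp c) (phi_in c) (in_chart c w) x.

End SMMSTheory.

(* [S'] is (M, u^-2 g, u^{-m-n} v^m dvol_g), with the same finite m.  For
   m <> 0 the equality of measures says that the function v of [S'] is v / u;
   for m = 0 that function plays no role. *)
Definition conformal R n (M : manifold R n) (m : R) (u : M -> R)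
    (S S' : smms M) : Prop :=
  [/\ dimpar S = m%:E, dimpar S' = m%:E &
    forall c x, ccod (atlas c) x ->
      scomp S' c x = (in_chart c u x) ^- 2 *: scomp S c x /\
      weighted_density S' c x =
        (in_chart c u x) `^ (- m - n%:R) * weighted_density S c x].

(* The case |m| = oo: [S'] is (M, g, e^{-f-phi} dvol_g). *)
Definition conformal_inf R n (M : manifold R n) (f : M -> R)
    (S S' : smms M) : Prop :=
  [/\ dimpar S = +oo%E \/ dimpar S = -oo%E, dimpar S' = dimpar S &
    forall c x, ccod (atlas c) x ->
      scomp S' c x = scomp S c x /\
      weighted_density S' c x =
        expR (- in_chart c f x) * weighted_density S c x].

(* Main.v *)
(** In a chart put w = ln u, so that the new metric is g' = e^{-2w} g.
    Comparing the measures, with det (u^-2 g) = u^{-2n} det g, gives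
    phi' = phi + m w.  The Christoffel symbols change by the tensor
    C^k_ij = - (delta^k_i w_j + delta^k_j w_i - g_ij w^k), and contracting
    d C + Gam C + C Gam + C C yields
    Ric' = Ric + (n-2) (Hess w + dw dw) + (Lap w - (n-2) |dw|^2) g.
    Adding Hess' phi' - (1/m) dphi' dphi', the mixed terms dphi dw cancel, and
    Hess w + dw dw = u^-1 Hess u gives the tensor formula; the scalar one is its
    trace with respect to g' = u^-2 g together with the gradient terms.  The
    symmetry of second derivatives is needed because Ric' contains d_j w_k with
    both orders of the indices. *)
Require Import Defs.
From mathcomp Require Import all_boot all_order all_algebra.
From mathcomp Require Import all_classical all_reals all_analysis.
From mathcomp Require Import ring lra.
Import Order.TTheory GRing.Theory Num.Theory.
Import numFieldNormedType.Exports.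
Local Open Scope ring_scope.
Set Implicit Arguments.
Unset Strict Implicit.
Unset Printing Implicit Defensive.

(** * Directional derivatives and Schwarz's theorem *)

Section DirectionalDerivatives.
Variables (R : realType) (V : normedModType R).
Implicit Types (f g : V -> R) (x v w : V).

(** The two difference quotients coincide as functions of h. This transfers one-variable results,
    such as the chain rule and the mean value theorem, to directional derivatives. *)
Lemma is_derive_line f x v (t d : R) :
  is_derive (t *: v + x) v f d <-> is_derive t 1 (fun h => f (h *: v + x)) d.
Proof.
have E : (fun h : R => h^-1 *:
      (((fun h => f (h *: v + x)) \o shift t) (h *: (1 : R)) - f (t *: v + x))) =
    (fun h => h^-1 *: ((f \o shift (t *: v + x)) (h *: v) - f (t *: v + x))).
  by apply/funext => h /=; rewrite scalerDl [h%:A]mulr1 addrA.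
by split=> -[df dv]; apply: DeriveDef; move: df dv;
  rewrite /derivable /derive E.
Qed.

(** Restricted to the line through x in direction v, this is the one-variable chain rule. *)
Lemma is_derive_compR (g : R -> R) f x v (dg df : R) :
  is_derive (f x) 1 g dg -> is_derive x v f df ->
  is_derive x v (fun y => g (f y)) (dg * df).
Proof.
move=> hg; rewrite -[x in is_derive x](add0r x) -(scale0r v).
move=> /is_derive_line hf; apply/is_derive_line.
by apply: (is_derive1_comp (f := g)); rewrite //= scale0r add0r.
Qed.

Lemma is_derive_bigsum (I : Type) (r : seq I) (P : pred I)
    (h : I -> V -> R) (dh : I -> R) x v :
  (forall i, P i -> is_derive x v (h i) (dh i)) ->
  is_derive x v (fun y => \sum_(i <- r | P i) h i y) (\sum_(i <- r | P i) dh i).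
Proof.
move=> dhP; elim: r => [|i r IH].
  rewrite big_nil (_ : (fun _ => _) = cst 0); first exact: is_derive_cst.
  by apply/funext => y; rewrite big_nil.
rewrite big_cons; under eq_fun do rewrite big_cons.
by case: ifP => // /dhP di; exact: is_deriveD.
Qed.

Lemma derivable_bigprod (I : Type) (r : seq I) (h : I -> V -> R) x v :
  (forall i, derivable (h i) x v) ->
  derivable (fun y => \prod_(i <- r) h i y) x v.
Proof.
move=> dh; elim: r => [|i r IH].
  rewrite (_ : (fun _ => _) = cst 1); first exact: derivable_cst.
  by apply/funext => y; rewrite big_nil.
rewrite (_ : (fun _ => _) = (fun y => h i y * \prod_(j <- r) h j y)).
  exact: (derivableM (dh i) IH).
by apply/funext => y; rewrite big_cons.
Qed.

(* [P a b] plays the role of [a *: v + b *: w + x]; describing it by its two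
   translation laws makes the statement symmetric in [v] and [w]. *)
Lemma mixed_difference f v w (P : R -> R -> V) (s : R) : 0 <= s ->
  (forall a b, P a b = a *: v + P 0 b) -> (forall a b, P a b = b *: w + P a 0) ->
  (forall a b : R, 0 <= a <= s -> 0 <= b <= s ->
    derivable f (P a b) v /\ derivable ('D_v f) (P a b) w) ->
  exists a b : R, [/\ 0 <= a <= s, 0 <= b <= s &
    f (P s s) - f (P s 0) - f (P 0 s) + f (P 0 0) =
    s ^+ 2 * 'D_w ('D_v f) (P a b)].
Proof.
move=> s0 Pv Pw df.
have s00 : (0 : R) <= 0 <= s by rewrite lexx s0.
have s0s : 0 <= s <= s by rewrite s0 lexx.
have dv g (a b : R) : derivable g (P a b) v ->
    is_derive a 1 (fun h => g (P h b)) ('D_v g (P a b)).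
  move=> /derivableP; rewrite {1}Pv => /is_derive_line.
  by under eq_fun do rewrite -Pv.
have dw g (a b : R) : derivable g (P a b) w ->
    is_derive b 1 (fun h => g (P a h)) ('D_w g (P a b)).
  move=> /derivableP; rewrite {1}Pw => /is_derive_line.
  by under eq_fun do rewrite -Pw.
(* The second difference is [F s - F 0]. The mean value theorem in the first variable turns it into
   [s * F' a]; [F' a] is in turn the increment of [G], and the theorem is applied again in the
   second variable. *)
pose F a : R := f (P a s) - f (P a 0).
pose F' a : R := 'D_v f (P a s) - 'D_v f (P a 0).
have dF (a : R) : 0 <= a <= s -> is_derive a 1 F (F' a).
  move=> ha; apply: is_deriveB; apply: dv.
    by case: (df a s ha s0s).
  by case: (df a 0 ha s00).
have [||a ha eF] := @MVT_segment _ F F' 0 s s0.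
- by move=> a; rewrite in_itv /= => /andP[a0 as_]; apply: dF; rewrite !ltW.
- apply: derivable_within_continuous => a; rewrite in_itv /= => ha.
  by have [] := dF a ha.
move: ha; rewrite in_itv /= => ha.
pose G b : R := 'D_v f (P a b).
pose G' b : R := 'D_w ('D_v f) (P a b).
have dG (b : R) : 0 <= b <= s -> is_derive b 1 G (G' b).
  by move=> hb; apply: dw; case: (df a b ha hb).
have [||b hb eG] := @MVT_segment _ G G' 0 s s0.
- by move=> b; rewrite in_itv /= => /andP[b0 bs]; apply: dG; rewrite !ltW.
- apply: derivable_within_continuous => b; rewrite in_itv /= => hb.
  by have [] := dG b hb.
move: hb; rewrite in_itv /= => hb.
exists a, b; split=> //.
have -> : s ^+ 2 * 'D_w ('D_v f) (P a b) = F s - F 0.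
  by rewrite eF -[F' a]/(G s - G 0) eG /G' subr0; ring.
by rewrite /F; ring.
Qed.

(** On a small parallelogram at x the same second difference, divided by s^2, is a value of each
    mixed derivative at some nearby point. Continuity at x then makes the two derivatives at x
    differ by less than any e. *)
Lemma derive_commute f x v w :
  (\near x, [/\ derivable f x v, derivable f x w,
     derivable ('D_v f) x w & derivable ('D_w f) x v]) ->
  {for x, continuous ('D_w ('D_v f))} ->
  {for x, continuous ('D_v ('D_w f))} ->
  'D_w ('D_v f) x = 'D_v ('D_w f) x.
Proof.
move=> df cvw cwv.
apply/eqP; rewrite -subr_eq0 -normr_le0; apply/ler_addgt0Pr => /= e' e0.
rewrite add0r; move: (e' : R) e0 => e {e'} e0.
have e20 : 0 < e / 2 by rewrite divr_gt0.
have [d d0 hd] : exists2 d : R, 0 < d & forall y, ball x d y ->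
    [/\ derivable f y v, derivable f y w,
     derivable ('D_v f) y w & derivable ('D_w f) y v] /\
    (`|'D_w ('D_v f) x - 'D_w ('D_v f) y| < e / 2 /\
     `|'D_v ('D_w f) x - 'D_v ('D_w f) y| < e / 2).
  apply/(nbhs_ballP x); apply: filterI => //.
  apply: filterI; first by apply: cvgr_dist_lt e20; exact: cvw.
  by apply: cvgr_dist_lt e20; exact: cwv.
have N0 : 0 < 1 + `|v| + `|w| by rewrite -addrA ltr_pwDl // addr_ge0.
(* With this side length every point of the parallelogram stays within d of x; the summand 1 keeps
   the denominator positive when v = w = 0. *)
pose s := d / 2 / (1 + `|v| + `|w|).
have s0 : 0 < s by rewrite !divr_gt0.
pose P (a b : R) : V := a *: v + b *: w + x.
have Pv a b : P a b = a *: v + P 0 b by rewrite /P scale0r add0r addrA.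
have Pw a b : P a b = b *: w + P a 0 by rewrite /P scale0r addr0 addrCA addrA.
have P0 : P 0 0 = x by rewrite /P !scale0r !add0r.
have hball (a b : R) : 0 <= a <= s -> 0 <= b <= s -> ball x d (P a b).
  move=> /andP[a0 as_] /andP[b0 bs]; rewrite -ball_normE /ball_ /=.
  rewrite /P opprD addrCA subrr addr0 normrN.
  rewrite (le_lt_trans (ler_normD _ _))// !normrZ !ger0_norm//.
  have sd : s * (1 + `|v| + `|w|) < d.
    by rewrite /s divfK ?gt_eqF// ltr_pdivrMr// ltr_pMr// ltr1n.
  have hs : a * `|v| + b * `|w| <= s * `|v| + s * `|w|.
    by rewrite lerD// ler_wpM2r.
  by move: sd; rewrite !mulrDr mulr1 => sd; lra.
have [a b ha hb|a [b [ha hb E1]]] :=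
    @mixed_difference f v w P s (ltW s0) Pv Pw.
  by have [[d1 _ d2 _] _] := hd _ (hball a b ha hb); split.
(* The roles of v and w are exchanged; the second difference changes only by the order of its two
   middle terms. *)
have [b' a' hb' ha'|b' [a' [hb' ha' E2]]] :=
    @mixed_difference f w v (fun b a => P a b) s (ltW s0)
      (fun b a => Pw a b) (fun b a => Pv a b).
  by have [[_ d1 _ d2] _] := hd _ (hball a' b' ha' hb'); split.
have [_ [c1 _]] := hd _ (hball a b ha hb).
have [_ [_ c2]] := hd _ (hball a' b' ha' hb').
have E : 'D_w ('D_v f) (P a b) = 'D_v ('D_w f) (P a' b').
  apply: (mulfI (lt0r_neq0 (exprn_gt0 2 s0))).
  apply: etrans (esym E1) (etrans _ E2).
  by congr (_ + _); exact: addrAC.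
rewrite (splitr e); apply: le_trans (ltW (ltrD c1 c2)).
by rewrite -E [X in _ <= _ + X]distrC ler_distD.
Qed.
End DirectionalDerivatives.

(** * The curvature of a conformal metric, as an identity at one point *)

(* [G], [Gam], [w], [W], [ddw], [dW] stand for the values at a point of g_ij,
   Gam^k_ij, d_i w, w^k = g^kl d_l w, d_i d_j w and d_i w^k.  Then [conf_dmetric]
   is d_m g_ij (compatibility of the connection with g), [conf_christoffel] is
   Gam'^k_ij - Gam^k_ij, and [conf_dchristoffel] its derivative d_m. *)
Section ConformalRicciAlgebra.
Variables (F : comNzRingType) (n : nat).
Variables (G : 'I_n -> 'I_n -> F) (Gam : 'I_n -> 'I_n -> 'I_n -> F).
Variables (w W : 'I_n -> F) (ddw dW : 'I_n -> 'I_n -> F).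

Definition conf_dmetric (m i j : 'I_n) : F :=
  \sum_p (Gam p m i * G p j + Gam p m j * G i p).

Definition conf_christoffel (k i j : 'I_n) : F :=
  - ((k == i)%:R * w j + (k == j)%:R * w i - G i j * W k).

Definition conf_dchristoffel (m k i j : 'I_n) : F :=
  - ((k == i)%:R * ddw m j + (k == j)%:R * ddw m i
     - (conf_dmetric m i j * W k + G i j * dW m k)).

Hypothesis G_sym : forall i j, G i j = G j i.
Hypothesis Gam_sym : forall k i j, Gam k i j = Gam k j i.
Hypothesis W_lower : forall i, \sum_k G i k * W k = w i.
Hypothesis ddw_sym : forall i j, ddw i j = ddw j i.
Hypothesis dW_lower : forall m i,
  \sum_k (conf_dmetric m i k * W k + G i k * dW m k) = ddw m i.

Local Notation C := conf_christoffel.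
Local Notation DC := conf_dchristoffel.
Local Notation Q := (\sum_p w p * W p).

Lemma sum_deltal (X : 'I_n -> F) j : \sum_i (i == j)%:R * X i = X j.
Proof.
rewrite (bigD1 j) //= eqxx mul1r big1 ?addr0 // => i /negPf ->.
by rewrite mul0r.
Qed.

Lemma sum_deltar (X : 'I_n -> F) j : \sum_i (j == i)%:R * X i = X j.
Proof.
by rewrite -[RHS](sum_deltal X); apply: eq_bigr => i _; rewrite eq_sym.
Qed.

(** For [X] the differential of a function, this is minus the correction to its Hessian. In the
    Ricci tensor it is used with [X] built from [Gam], [w] and [C]. *)
Lemma conf_christoffel_up (X : 'I_n -> F) i k :
  \sum_p X p * C p i k = - (X i * w k + X k * w i - G i k * \sum_p X p * W p).
Proof.
rewrite -(sum_deltal X i) -(sum_deltal X k) !mulr_suml mulr_sumr.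
rewrite -big_split -sumrB -sumrN /=; apply: eq_bigr => p _.
by rewrite /C; ring.
Qed.

Lemma conf_christoffel_down (X : 'I_n -> F) i j :
  \sum_p C i j p * X p =
  - ((i == j)%:R * (\sum_p w p * X p) + X i * w j
     - W i * \sum_p G j p * X p).
Proof.
rewrite -(sum_deltar X i) mulr_suml !mulr_sumr.
rewrite -big_split -sumrB -sumrN /=; apply: eq_bigr => p _.
by rewrite /C; ring.
Qed.

Lemma conf_christoffel_sym k i j : C k i j = C k j i.
Proof. by rewrite /C (G_sym i j); ring. Qed.

Lemma sum_delta_diag : \sum_(i < n) (i == i)%:R = n%:R :> F.
Proof.
under eq_bigr do rewrite eqxx.
by rewrite sumr_const card_ord.
Qed.

(** The last two terms of [C] cancel after lowering the index of [W]. The result is the derivative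
    of -n w, the logarithm of the ratio of the volume densities of g' and g. *)
Lemma conf_christoffel_trace k : \sum_i C i i k = - (n%:R * w k).
Proof.
rewrite /C sumrN sumrB big_split /= -mulr_suml sum_delta_diag sum_deltal.
by under [X in _ - X]eq_bigr do rewrite G_sym; rewrite W_lower addrK.
Qed.

Lemma conf_dchristoffel_trace m k : \sum_i DC m i i k = - (n%:R * ddw m k).
Proof.
rewrite /DC sumrN sumrB big_split /= -mulr_suml sum_delta_diag.
rewrite (sum_deltal (ddw m)).
rewrite (eq_bigr (fun i => conf_dmetric m k i * W i + G k i * dW m i)).
  by rewrite dW_lower addrK.
move=> i _; rewrite (G_sym i k); congr (_ * _ + _).
by apply: eq_bigr => p _; rewrite addrC (G_sym k) (G_sym p i).
Qed.

(** [T] is the trace of the connection, [A] the first-order part of Hess w up to sign, and [B] the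
    connection with its upper index lowered to k and one lower index contracted with grad w. [T]
    with free index and [B] cancel in the Ricci tensor. *)
Local Notation T j := (\sum_i Gam i i j).
Local Notation A j k := (\sum_p Gam p j k * w p).
Local Notation B j k := (\sum_i \sum_p Gam p i j * G p k * W i).

(** The two [B] terms are the two halves of d_i g_jk, given by metric compatibility, contracted with
    grad w. *)
Lemma conf_dchristoffel_div j k :
  \sum_i DC i i j k =
  - (ddw j k + ddw k j) + B j k + B k j + G j k * \sum_i dW i i.
Proof.
rewrite /DC sumrN sumrB !big_split /= -mulr_sumr.
rewrite (sum_deltal (fun i => ddw i k)) (sum_deltal (fun i => ddw i j)).
rewrite (_ : \sum_i conf_dmetric i j k * W i = B j k + B k j); first by ring.
rewrite -big_split /=; apply: eq_bigr => i _.
rewrite mulr_suml -big_split /=; apply: eq_bigr => p _.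
by rewrite (G_sym j p); ring.
Qed.

(** The left side is the Ricci contraction for the connection [Gam] + [C] with the derivatives of
    [Gam] left out, and the double sum on the right is its analogue for [Gam] alone. The product is
    expanded and every contraction computed separately; the [B] terms of the divergence cancel
    against those of the mixed products. *)
Lemma conf_ricci_algebra (lap : F) j k :
  lap = \sum_i dW i i + \sum_p T p * W p ->
  \sum_i (DC i i j k - DC j i i k +
    \sum_p ((Gam i i p + C i i p) * (Gam p j k + C p j k)
            - (Gam i j p + C i j p) * (Gam p i k + C p i k))) =
  \sum_i \sum_p (Gam i i p * Gam p j k - Gam i j p * Gam p i k) +
  (n%:R - 2) * (ddw j k - A j k + w j * w k)
  + (lap - (n%:R - 2) * Q) * G j k.
Proof.
move=> ->.
(* [S3], [S5] and [S6] are contractions of [Gam] with [C]; [S4] serves both for [X] from [Gam] and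
   for [X] from [C], the latter completed by [S7]; [S8] is the remaining product of [C] with
   itself. *)
have S3 : \sum_i \sum_p Gam i i p * C p j k =
    - (T j * w k + T k * w j - G j k * \sum_p T p * W p).
  rewrite exchange_big /= -(conf_christoffel_up (fun p => T p)).
  by apply: eq_bigr => p _; rewrite mulr_suml.
have S4 X : \sum_i \sum_p C i i p * X p = - n%:R * \sum_p w p * X p.
  rewrite exchange_big /= mulr_sumr; apply: eq_bigr => p _.
  by rewrite -mulr_suml conf_christoffel_trace; ring.
have S5 : \sum_i \sum_p Gam i j p * C p i k = - (T j * w k + A j k - B j k).
  under eq_bigr do rewrite conf_christoffel_up.
  rewrite sumrN sumrB big_split /= -mulr_suml.
  congr (- (_ * _ + _ - _)); first by apply: eq_bigr => i _; rewrite Gam_sym.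
  rewrite exchange_big /=; apply: eq_bigr => i _; rewrite mulr_sumr.
  by apply: eq_bigr => p _; rewrite (Gam_sym i j p); ring.
have S6 : \sum_i \sum_p C i j p * Gam p i k = - (A j k + T k * w j - B k j).
  under eq_bigr do rewrite (conf_christoffel_down (fun p => Gam p _ k)).
  rewrite sumrN sumrB big_split /= -mulr_suml.
  rewrite (sum_deltal (fun i => \sum_p w p * Gam p i k)).
  congr (- (_ + _ - _)); first by apply: eq_bigr => i _; rewrite mulrC.
  apply: eq_bigr => i _; rewrite mulr_sumr.
  by apply: eq_bigr => p _; rewrite (G_sym p j); ring.
have S7 : \sum_p w p * C p j k = - (2 * w j * w k - G j k * Q).
  by rewrite conf_christoffel_up; ring.
(* Contracted with grad w, the two terms w_j w^i cancel and only the Kronecker term survives. *)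
have CW i : \sum_p C i j p * W p = - ((i == j)%:R * Q).
  by rewrite conf_christoffel_down W_lower; ring.
have S8 : \sum_i \sum_p C i j p * C p i k =
    (n%:R + 2) * w j * w k - 2 * G j k * Q.
  under eq_bigr do rewrite conf_christoffel_up CW.
  rewrite sumrN sumrB big_split /= -mulr_suml.
  have -> : \sum_i C i j i = - (n%:R * w j).
    rewrite -conf_christoffel_trace.
    by apply: eq_bigr => i _; exact: conf_christoffel_sym.
  have -> : \sum_i C i j k * w i = - (2 * w j * w k - G j k * Q).
    by rewrite -S7; apply: eq_bigr => i _; exact: mulrC.
  rewrite (_ : \sum_i G i k * _ = - (G j k * Q)); first by ring.
  rewrite -mulNr -(sum_deltal (fun i => - G i k * Q)).
  by apply: eq_bigr => i _; ring.
rewrite (eq_bigr (fun i => DC i i j k - DC j i i k +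
   (\sum_p (Gam i i p * Gam p j k - Gam i j p * Gam p i k)
    + \sum_p Gam i i p * C p j k + \sum_p C i i p * Gam p j k
    + \sum_p C i i p * C p j k - \sum_p Gam i j p * C p i k
    - \sum_p C i j p * Gam p i k - \sum_p C i j p * C p i k))); last first.
  move=> i _; congr (_ + _); rewrite -!big_split -!sumrB /=.
  by apply: eq_bigr => p _; ring.
rewrite !big_split /= conf_dchristoffel_div.
have -> : \sum_i - DC j i i k = n%:R * ddw j k.
  by rewrite sumrN conf_dchristoffel_trace opprK.
rewrite !sumrN.
rewrite S3 (S4 (fun p => Gam p j k)) (S4 (fun p => C p j k)) S5 S6 S7 S8.
rewrite (ddw_sym k j).
have -> : \sum_p w p * Gam p j k = A j k.
  by apply: eq_bigr => p _; exact: mulrC.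
by ring.
Qed.
(** The trace of the Hessian is the divergence of the gradient. Differentiating w_j = g_jk w^k, one
    half of the metric derivative cancels the term Gam^k_ij w_k and the other half completes d_i w^k
    to a covariant derivative. *)
Lemma conf_laplacian_algebra (Ginv : 'I_n -> 'I_n -> F) :
  (forall i k, \sum_l Ginv i l * G l k = (i == k)%:R) ->
  \sum_i \sum_j Ginv i j * (ddw i j - \sum_k Gam k i j * w k) =
  \sum_i dW i i + \sum_p T p * W p.
Proof.
move=> GinvG.
have Ginv_lower (X : 'I_n -> F) m :
    \sum_l Ginv m l * \sum_k G l k * X k = X m.
  under eq_bigr do rewrite mulr_sumr.
  rewrite exchange_big /= -(sum_deltar X); apply: eq_bigr => k _.
  by rewrite -GinvG mulr_suml; apply: eq_bigr => l _; rewrite mulrA.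
have -> : \sum_p T p * W p = \sum_i \sum_p Gam i i p * W p.
  by rewrite exchange_big; apply: eq_bigr => p _; rewrite mulr_suml.
rewrite -big_split /=; apply: eq_bigr => m _.
rewrite -(Ginv_lower (dW m)) -(Ginv_lower (fun l => \sum_p Gam l m p * W p)).
rewrite -big_split /=; apply: eq_bigr => l _; rewrite -mulrDr -dW_lower big_split /=.
congr (_ * _); rewrite addrAC addrC; congr (_ + _).
rewrite /conf_dmetric; under eq_bigr do rewrite mulr_suml.
rewrite exchange_big -sumrB /=; apply: eq_bigr => p _.
rewrite -W_lower !mulr_sumr -sumrB; apply: eq_bigr => k _.
by ring.
Qed.
End ConformalRicciAlgebra.

(** * Partial derivatives *)

Section PartialCalculus.
Variables (R : realType) (n : nat).
Implicit Types (f g : 'rV[R]_n -> R) (x : 'rV[R]_n) (A : set 'rV[R]_n).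
Implicit Types (i : 'I_n).

(** First-order derivability along the axes is what the product and chain rules for [partial] use,
    so composite expressions such as the inverse metric are only followed to this order. *)
Definition pderivable A f : Prop :=
  forall x, A x -> forall i, derivable f x (delta_mx 0 i : 'rV[R]_n).

Lemma is_derive_partial f x i d :
  is_derive x (delta_mx 0 i : 'rV[R]_n) f d -> partial i f x = d.
Proof. by case. Qed.

Lemma partial_derivable f x i :
  derivable f x (delta_mx 0 i : 'rV[R]_n) ->
  is_derive x (delta_mx 0 i : 'rV[R]_n) f (partial i f x).
Proof. exact: derivableP. Qed.

Lemma partial_cst (c : R) x i : partial i (fun=> c) x = 0.
Proof. exact: derive_cst. Qed.

Lemma partialD f g x i : derivable f x (delta_mx 0 i : 'rV[R]_n) ->
  derivable g x (delta_mx 0 i : 'rV[R]_n) ->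
  partial i (fun y => f y + g y) x = partial i f x + partial i g x.
Proof. by move=> df dg; exact: deriveD. Qed.

Lemma partialN f x i : derivable f x (delta_mx 0 i : 'rV[R]_n) ->
  partial i (fun y => - f y) x = - partial i f x.
Proof. by move=> df; exact: deriveN. Qed.

Lemma partialM f g x i : derivable f x (delta_mx 0 i : 'rV[R]_n) ->
  derivable g x (delta_mx 0 i : 'rV[R]_n) ->
  partial i (fun y => f y * g y) x = partial i f x * g x + f x * partial i g x.
Proof.
move=> df dg; apply: etrans (deriveM df dg) _.
by rewrite addrC; congr (_ + _); exact: mulrC.
Qed.

Lemma partialZ (c : R) f x i : derivable f x (delta_mx 0 i : 'rV[R]_n) ->
  partial i (fun y => c * f y) x = c * partial i f x.
Proof. by move=> df; exact: deriveZ. Qed.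

Lemma partial_sum (I : finType) (h : I -> 'rV[R]_n -> R) x i :
  (forall k, derivable (h k) x (delta_mx 0 i : 'rV[R]_n)) ->
  partial i (fun y => \sum_k h k y) x = \sum_k partial i (h k) x.
Proof.
move=> dh; apply: is_derive_partial; apply: is_derive_bigsum => k _.
by apply: partial_derivable; exact: dh.
Qed.

Lemma partial_comp (h : R -> R) f x i (dh : R) :
  is_derive (f x) 1 h dh -> derivable f x (delta_mx 0 i : 'rV[R]_n) ->
  partial i (fun y => h (f y)) x = dh * partial i f x.
Proof.
move=> hh /partial_derivable df.
by have [_] := is_derive_compR hh df.
Qed.

Lemma pderivable_cst A (c : R) : pderivable A (fun=> c).
Proof. by move=> x Ax i; exact: derivable_cst. Qed.

Lemma pderivableD A f g : pderivable A f -> pderivable A g ->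
  pderivable A (fun y => f y + g y).
Proof. by move=> df dg x Ax i; exact: (derivableD (df x Ax i) (dg x Ax i)). Qed.

Lemma pderivableN A f : pderivable A f -> pderivable A (fun y => - f y).
Proof. by move=> df x Ax i; exact: (derivableN (df x Ax i)). Qed.

Lemma pderivableM A f g : pderivable A f -> pderivable A g ->
  pderivable A (fun y => f y * g y).
Proof. by move=> df dg x Ax i; exact: (derivableM (df x Ax i) (dg x Ax i)). Qed.

Lemma pderivable_sum A (I : finType) (h : I -> 'rV[R]_n -> R) :
  (forall k, pderivable A (h k)) -> pderivable A (fun y => \sum_k h k y).
Proof.
move=> dh x Ax i; case: (@is_derive_bigsum _ _ _ (index_enum I) xpredT h
  (fun k => partial i (h k) x) x (delta_mx 0 i : 'rV[R]_n)) => // k _.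
exact/partial_derivable/dh.
Qed.

Lemma pderivable_prod A (I : finType) (h : I -> 'rV[R]_n -> R) :
  (forall k, pderivable A (h k)) -> pderivable A (fun y => \prod_k h k y).
Proof. by move=> dh x Ax i; apply: derivable_bigprod => k; exact: dh. Qed.

Lemma pderivable_comp A (h dh : R -> R) f :
  (forall y, A y -> is_derive (f y) 1 h (dh (f y))) ->
  pderivable A f -> pderivable A (fun y => h (f y)).
Proof.
move=> hh df x Ax i.
by case: (is_derive_compR (hh x Ax) (partial_derivable (df x Ax i))).
Qed.

Lemma pderivableV A f : (forall y, A y -> f y != 0) -> pderivable A f ->
  pderivable A (fun y => (f y)^-1).
Proof. by move=> f0 df x Ax i; exact: derivableV (f0 x Ax) (df x Ax i). Qed.

(** * Locality, symmetry of second partials and inverse matrices on an open set *)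

Section OpenSet.
Variables (A : set 'rV[R]_n).
Hypothesis A_open : open A.

Lemma near_open f g x : A x -> (forall y, A y -> f y = g y) ->
  \near x, f x = g x.
Proof.
move=> Ax fg; apply: filterS (open_nbhs_nbhs (conj A_open Ax)) => y Ay.
exact: fg.
Qed.

(** A derivative depends only on the germ, so identities known only on the open set [A] may be
    differentiated there. *)
Lemma partial_eq_on f g x i : A x -> (forall y, A y -> f y = g y) ->
  partial i f x = partial i g x.
Proof. by move=> Ax fg; apply: near_eq_derive; exact: near_open. Qed.

Lemma pderivable_eq_on f g : (forall y, A y -> f y = g y) ->
  pderivable A f -> pderivable A g.
Proof.
move=> fg df x Ax i; apply: near_eq_derivable (df x Ax i).
exact: near_open.
Qed.

Lemma smooth_on_pderivable f : smooth_on A f -> pderivable A f.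
Proof. by move=> sf x Ax i; have [_ /(_ i) [dA _]] := sf 1%N; exact: dA. Qed.

Lemma smooth_on_partial f i : smooth_on A f -> smooth_on A (partial i f).
Proof. by move=> sf k; have [_ /(_ i) [_ dk]] := sf k.+1; exact: dk. Qed.

Lemma smooth_on_pderivable_partial f i :
  smooth_on A f -> pderivable A (partial i f).
Proof. by move=> sf; apply: smooth_on_pderivable; exact: smooth_on_partial. Qed.

Lemma partial_commute f x i j : smooth_on A f -> A x ->
  partial i (partial j f) x = partial j (partial i f) x.
Proof.
move=> sf Ax.
apply: (@derive_commute R 'rV[R]_n f x (delta_mx 0 j) (delta_mx 0 i)).
- apply: filterS (open_nbhs_nbhs (conj A_open Ax)) => y Ay; split.
  + exact: smooth_on_pderivable.
  + exact: smooth_on_pderivable.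
  + exact: (@smooth_on_pderivable_partial f j sf y Ay i).
  + exact: (@smooth_on_pderivable_partial f i sf y Ay j).
- have [c _] := @smooth_on_partial _ i (@smooth_on_partial _ j sf) 0%N; exact: c.
- have [c _] := @smooth_on_partial _ j (@smooth_on_partial _ i sf) 0%N; exact: c.
Qed.

(** By Cramer's rule an entry is a signed minor divided by the determinant, and determinants are
    polynomials in the entries. *)
Lemma pderivable_invmx (g : 'rV[R]_n -> 'M[R]_n) :
  (forall y, A y -> g y \in unitmx) ->
  (forall i j, pderivable A (fun y => g y i j)) ->
  forall i j, pderivable A (fun y => invmx (g y) i j).
Proof.
move=> gU dg i j.
have ddet m (h : 'rV[R]_n -> 'M[R]_m) :
    (forall a b, pderivable A (fun y => h y a b)) ->
    pderivable A (fun y => \det (h y)).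
  move=> dh; apply: pderivable_sum => s; apply: pderivableM.
    exact: pderivable_cst.
  by apply: pderivable_prod => a; exact: dh.
apply: (@pderivable_eq_on (fun y => (\det (g y))^-1 * \adj (g y) i j)).
  by move=> y Ay; rewrite /invmx (gU y Ay) [RHS]mxE.
apply: pderivableM.
  apply: pderivableV; last exact: ddet.
  by move=> y Ay; rewrite -unitfE -unitmxE gU.
apply: (@pderivable_eq_on (fun y => (-1) ^+ (j + i) * \det (row' j (col' i (g y))))).
  by move=> y Ay; rewrite [RHS]mxE.
apply: pderivableM; first exact: pderivable_cst.
apply: ddet => a b; apply: pderivable_eq_on (dg (lift j a) (lift i b)) => y _.
by rewrite !mxE.
Qed.

End OpenSet.
End PartialCalculus.

(** * Conformal change of a metric in a chart *)

Section LocalMetric.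
Variables (R : realType) (n : nat) (A : set 'rV[R]_n).
Hypothesis A_open : open A.
Variable g : 'rV[R]_n -> 'M[R]_n.
Hypothesis g_der : forall i j, pderivable A (fun y => g y i j).
Hypothesis g_sym : forall y, A y -> (g y)^T = g y.
Hypothesis g_unit : forall y, A y -> g y \in unitmx.

Lemma metricC y i j : A y -> g y i j = g y j i.
Proof. by move=> Ay; rewrite -{1}(g_sym Ay) mxE. Qed.

Lemma invmx_metricC y i j : A y -> invmx (g y) i j = invmx (g y) j i.
Proof. by move=> Ay; rewrite -{1}(g_sym Ay) -trmx_inv mxE. Qed.

Lemma sum_invmx_metric y i k : A y ->
  \sum_l invmx (g y) i l * g y l k = (i == k)%:R.
Proof.
by move=> Ay; have := mulVmx (g_unit Ay) => /matrixP/(_ i k); rewrite !mxE.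
Qed.

Lemma sum_metric_invmx y i k : A y ->
  \sum_l g y i l * invmx (g y) l k = (i == k)%:R.
Proof.
by move=> Ay; have := mulmxV (g_unit Ay) => /matrixP/(_ i k); rewrite !mxE.
Qed.

Lemma sum_metric_invmxl y (X : 'I_n -> R) i : A y ->
  \sum_k g y i k * (\sum_l invmx (g y) k l * X l) = X i.
Proof.
move=> Ay; under eq_bigr do rewrite mulr_sumr.
rewrite exchange_big /= -[RHS](sum_deltar X); apply: eq_bigr => l _.
rewrite -(sum_metric_invmx _ _ Ay) mulr_suml.
by apply: eq_bigr => k _; rewrite mulrA.
Qed.

Lemma partial_metricC y m i j : A y ->
  partial m (fun z => g z i j) y = partial m (fun z => g z j i) y.
Proof. by move=> Ay; apply: (partial_eq_on A_open) => // z Az; exact: metricC. Qed.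

Lemma christoffelC y k i j : A y -> christoffel g k i j y = christoffel g k j i y.
Proof.
move=> Ay; congr (_ * _); apply: eq_bigr => l _.
by rewrite (partial_metricC l i j Ay) [partial i _ _ + _]addrC.
Qed.

(** These are the Christoffel symbols of the first kind: lowering the index cancels the inverse
    metric. *)
Lemma christoffel_lower y a i j : A y ->
  \sum_k g y a k * christoffel g k i j y =
  2^-1 * (partial i (fun z => g z j a) y + partial j (fun z => g z i a) y
          - partial a (fun z => g z i j) y).
Proof.
move=> Ay; rewrite /christoffel.
under eq_bigr do rewrite mulrCA.
by rewrite -mulr_sumr (sum_metric_invmxl (fun l => partial i (fun z => g z j l) y
  + partial j (fun z => g z i l) y - partial l (fun z => g z i j) y)).
Qed.

(** In the sum of the two first-kind symbols the derivatives in directions i and j cancel, and the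
    two halves of d_m g_ij add up. *)
Lemma metric_compat y m i j : A y ->
  partial m (fun z => g z i j) y =
  conf_dmetric (g y) (fun k a b => christoffel g k a b y) m i j.
Proof.
move=> Ay; rewrite /conf_dmetric big_split /=.
rewrite (eq_bigr (fun p => g y j p * christoffel g p m i y)); last first.
  by move=> p _; rewrite (metricC p j Ay) mulrC.
rewrite [X in _ = _ + X](eq_bigr
  (fun p => g y i p * christoffel g p m j y)); last first.
  by move=> p _; rewrite mulrC.
by rewrite !christoffel_lower // (partial_metricC m j i Ay); lra.
Qed.

Lemma pderivable_christoffel k i j :
  (forall m a b, pderivable A (partial m (fun z => g z a b))) ->
  pderivable A (christoffel g k i j).
Proof.
move=> g_der2; apply: pderivableM; first exact: pderivable_cst.
apply: pderivable_sum => l; apply: pderivableM.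
  exact: pderivable_invmx.
apply: pderivableD; last exact: pderivableN.
exact: pderivableD.
Qed.

Lemma gtraceD T1 T2 y : gtrace g (T1 + T2) y = gtrace g T1 y + gtrace g T2 y.
Proof.
rewrite /gtrace -big_split; apply: eq_bigr => i _.
by rewrite -big_split; apply: eq_bigr => j _; rewrite mxE mulrDr.
Qed.

Lemma gtraceZ c T y : gtrace g (c *: T) y = c * gtrace g T y.
Proof.
rewrite /gtrace mulr_sumr; apply: eq_bigr => i _.
by rewrite mulr_sumr; apply: eq_bigr => j _; rewrite mxE mulrCA.
Qed.

Lemma gtraceN T y : gtrace g (- T) y = - gtrace g T y.
Proof. by rewrite -scaleN1r gtraceZ mulN1r. Qed.

Lemma gtrace_metric y : A y -> gtrace g (g y) y = n%:R.
Proof.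
move=> Ay; rewrite /gtrace -(sum_delta_diag R n); apply: eq_bigr => i _.
rewrite -(sum_invmx_metric i i Ay); apply: eq_bigr => j _.
by rewrite (metricC i j Ay).
Qed.

Lemma gdotE f h y :
  gdot g f h y =
  \sum_k partial k f y * \sum_l invmx (g y) k l * partial l h y.
Proof.
apply: eq_bigr => k _; rewrite mulr_sumr; apply: eq_bigr => l _.
by rewrite mxE mulrCA.
Qed.

Lemma gdotC f h y : A y -> gdot g f h y = gdot g h f y.
Proof.
move=> Ay; rewrite /gdot /gtrace exchange_big; apply: eq_bigr => i _.
by apply: eq_bigr => j _; rewrite (invmx_metricC _ _ Ay) !mxE [partial j _ _ * _]mulrC.
Qed.

(** * Connection, Ricci tensor, Hessian and trace of the metric s g *)

Section ConformalChange.
Variables (g' : 'rV[R]_n -> 'M[R]_n) (s w : 'rV[R]_n -> R).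
Hypothesis g_der2 :
  forall m i j, pderivable A (partial m (fun y => g y i j)).
Hypothesis w_der2 : forall i, pderivable A (partial i w).
Hypothesis w_sym : forall y i j, A y ->
  partial i (partial j w) y = partial j (partial i w) y.
Hypothesis s_neq0 : forall y, A y -> s y != 0.
Hypothesis s_der : pderivable A s.
(* s = e^{-2w} *)
Hypothesis partial_s : forall y i, A y ->
  partial i s y = - 2 * s y * partial i w y.
Hypothesis g'E : forall y, A y -> g' y = s y *: g y.

(** The gradient of w is taken with respect to the original metric g; it takes the place of [W] in
    the pointwise algebra. *)
Definition conf_gradient (y : 'rV[R]_n) (k : 'I_n) : R :=
  \sum_l invmx (g y) k l * partial l w y.

Lemma conf_invmxE y : A y -> invmx (g' y) = (s y)^-1 *: invmx (g y).
Proof. by move=> Ay; rewrite g'E// invmxZ// unitmxZ ?g_unit// unitfE s_neq0. Qed.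

Lemma partial_conf_metric y m i j : A y ->
  partial m (fun z => g' z i j) y =
  s y * (partial m (fun z => g z i j) y - 2 * partial m w y * g y i j).
Proof.
move=> Ay.
rewrite (partial_eq_on A_open (g := fun z => s z * g z i j) m Ay); last first.
  by move=> z Az; rewrite g'E// mxE.
rewrite partialM; [|exact: s_der|exact: g_der].
by rewrite partial_s//; ring.
Qed.

(** One summand of the formula for Gam': a is g^kl, c is s, and p, q, r are derivatives of g. The
    factor c cancels against the inverse metric, and the extra terms come from the derivative of
    s. *)
Lemma conf_christoffel_term (a p q r wi wj wl gj gi gij c : R) : c != 0 ->
  2^-1 * (c^-1 * a * (c * (p - 2 * wi * gj) + c * (q - 2 * wj * gi)
                      - c * (r - 2 * wl * gij))) =
  2^-1 * (a * (p + q - r)) - (a * gj * wi + a * gi * wj - gij * (a * wl)).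
Proof. by move=> c0; field. Qed.

Lemma christoffel_conf y k i j : A y ->
  christoffel g' k i j y = christoffel g k i j y +
  conf_christoffel (g y) (fun l => partial l w y) (conf_gradient y) k i j.
Proof.
move=> Ay; rewrite /christoffel conf_invmxE//.
transitivity (2^-1 * \sum_l invmx (g y) k l *
    (partial i (fun z => g z j l) y + partial j (fun z => g z i l) y
     - partial l (fun z => g z i j) y)
  + - (\sum_l invmx (g y) k l * g y l j * partial i w y
     + \sum_l invmx (g y) k l * g y l i * partial j w y
     - \sum_l g y i j * (invmx (g y) k l * partial l w y))).
  rewrite -big_split -sumrB -sumrN !mulr_sumr -big_split /=.
  apply: eq_bigr => l _; rewrite mxE !partial_conf_metric//.
  rewrite (metricC l i Ay) (metricC l j Ay).
  exact: conf_christoffel_term (s_neq0 Ay).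
have sumwE a h : \sum_l invmx (g y) k l * g y l a * h = (k == a)%:R * h.
  by rewrite -mulr_suml (sum_invmx_metric k a Ay).
congr (_ + - (_ - _)).
  by rewrite [RHS]addrC; congr (_ + _); exact: sumwE.
exact: (esym (mulr_sumr _ _ _ _)).
Qed.

Lemma conf_gradient_der k : pderivable A (fun y => conf_gradient y k).
Proof.
apply: pderivable_sum => l; apply: pderivableM; last exact: w_der2.
exact: pderivable_invmx.
Qed.

(** The product rule produces d_m g_ij, which metric compatibility rewrites through the Christoffel
    symbols, the form that the pointwise algebra expects. *)
Lemma partial_christoffel_conf y m k i j : A y ->
  partial m (christoffel g' k i j) y = partial m (christoffel g k i j) y +
  conf_dchristoffel (g y) (fun k a b => christoffel g k a b y)
    (conf_gradient y) (fun a b => partial a (partial b w) y)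
    (fun a b => partial a (fun z => conf_gradient z b) y) m k i j.
Proof.
move=> Ay.
rewrite (partial_eq_on A_open m Ay (fun z Az => @christoffel_conf z k i j Az)).
have dW := @conf_gradient_der k y Ay m.
have dwi := @w_der2 i y Ay m.
have dwj := @w_der2 j y Ay m.
have dg := @g_der i j y Ay m.
have dcw (c : bool) (h : 'rV[R]_n -> R) : derivable h y (delta_mx 0 m : 'rV[R]_n) ->
    derivable (fun z => c%:R * h z) y (delta_mx 0 m : 'rV[R]_n).
  exact: (derivableM (derivable_cst _ _ _)).
have dS : derivable (fun z => (k == i)%:R * partial j w z
    + (k == j)%:R * partial i w z) y (delta_mx 0 m : 'rV[R]_n).
  exact: (derivableD (dcw _ _ dwj) (dcw _ _ dwi)).
have dP : derivable (fun z => g z i j * conf_gradient z k) y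
    (delta_mx 0 m : 'rV[R]_n) by exact: (derivableM dg dW).
rewrite partialD; last 2 first.
- exact: (@pderivable_christoffel k i j g_der2 y Ay m).
- exact: (derivableN (derivableB dS dP)).
congr (_ + _).
rewrite partialN; last exact: (derivableB dS dP).
congr (- _); apply: etrans (partialD dS (derivableN dP)) _.
rewrite (partialN dP) (partialM dg dW) -(metric_compat m i j Ay).
congr (_ - _); apply: etrans (partialD (dcw _ _ dwj) (dcw _ _ dwi)) _.
by rewrite (partialZ _ dwj) (partialZ _ dwi).
Qed.

Lemma conf_gradient_lower y i : A y ->
  \sum_k g y i k * conf_gradient y k = partial i w y.
Proof. by move=> Ay; exact: (sum_metric_invmxl (fun l => partial l w y)). Qed.

(** This is the derivative of g_ik w^k = d_i w. It determines d_m w^k implicitly, so the derivative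
    of the inverse metric need not be computed. *)
Lemma partial_conf_gradient_lower y m i : A y ->
  \sum_k (conf_dmetric (g y) (fun k a b => christoffel g k a b y) m i k
            * conf_gradient y k
          + g y i k * partial m (fun z => conf_gradient z k) y) =
  partial m (partial i w) y.
Proof.
move=> Ay.
rewrite -(partial_eq_on A_open m Ay (fun z Az => @conf_gradient_lower z i Az)).
rewrite partial_sum => [|k].
  apply: eq_bigr => k _; rewrite partialM ?metric_compat//; first exact: g_der.
  exact: conf_gradient_der.
exact: (derivableM (@g_der i k y Ay m) (@conf_gradient_der k y Ay m)).
Qed.

Lemma gdot_conf_gradient f y :
  gdot g f w y = \sum_k partial k f y * conf_gradient y k.
Proof. exact: gdotE. Qed.

Lemma laplacian_conf_gradient y : A y ->
  laplacian g w y =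
  \sum_i partial i (fun z => conf_gradient z i) y
  + \sum_p (\sum_i christoffel g i i p y) * conf_gradient y p.
Proof.
move=> Ay.
rewrite -(@conf_laplacian_algebra R n (g y) (fun k a b => christoffel g k a b y)
  (fun l => partial l w y) (conf_gradient y)
  (fun a b => partial a (partial b w) y)
  (fun a b => partial a (fun z => conf_gradient z b) y)
  (fun i => conf_gradient_lower i Ay)
  (fun m i => partial_conf_gradient_lower m i Ay) (invmx (g y))
  (fun i k => sum_invmx_metric i k Ay)).
apply: eq_bigr => i _; apply: eq_bigr => j _; rewrite mxE.
by [].
Qed.

Lemma ricci_conf y : A y ->
  ricci g' y = ricci g y
    + (n%:R - 2) *: (hessian g w y + dtensor w w y)
    + (laplacian g w y - (n%:R - 2) * gdot g w w y) *: g y.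
Proof.
move=> Ay; apply/matrixP => k j.
have hE : hessian g w y k j = partial j (partial k w) y
    - \sum_p christoffel g p j k y * partial p w y.
  rewrite mxE (w_sym k j Ay); congr (_ - _); apply: eq_bigr => p _.
  by rewrite (christoffelC p k j Ay).
have E := @conf_ricci_algebra R n (g y) (fun k a b => christoffel g k a b y)
  (fun l => partial l w y) (conf_gradient y)
  (fun a b => partial a (partial b w) y)
  (fun a b => partial a (fun z => conf_gradient z b) y)
  (fun i j => metricC i j Ay) (fun k i j => christoffelC k i j Ay)
  (fun i => conf_gradient_lower i Ay) (fun i j => w_sym i j Ay)
  (fun m i => partial_conf_gradient_lower m i Ay) _ j k
  (laplacian_conf_gradient Ay).
have -> (a b : R) :
    (ricci g y + a *: (hessian g w y + dtensor w w y) + b *: g y) k j =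
    ricci g y k j + a * (hessian g w y k j + dtensor w w y k j) + b * g y k j.
  by rewrite !mxE.
rewrite hE gdot_conf_gradient (metricC k j Ay).
have -> : dtensor w w y k j = partial j w y * partial k w y.
  by rewrite mxE mulrC.
have rE h : ricci h y k j = \sum_i riemann h i k i j y by rewrite mxE.
rewrite !rE.
have split_sum (X S P Q : R) : X + S + P + Q = X + (S + P + Q).
  by rewrite !addrA.
(* The derivatives of the old Christoffel symbols are split off; the rest of the right side is that
   of [conf_ricci_algebra]. Replacing it by the left side there leaves a comparison for each i. *)
have -> : \sum_i riemann g i k i j y =
    \sum_i (partial i (christoffel g i j k) y - partial j (christoffel g i i k) y)
    + \sum_i \sum_p (christoffel g i i p y * christoffel g p j k y
                   - christoffel g i j p y * christoffel g p i k y).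
  by rewrite -big_split.
rewrite split_sum -E -big_split /=.
apply: eq_bigr => i _.
rewrite /riemann !partial_christoffel_conf//.
rewrite opprD addrACA [RHS]addrA; congr (_ + _).
by apply: eq_bigr => p _; rewrite !(christoffel_conf _ _ _ Ay).
Qed.

(** Only the connection changes, so the correction is the contraction of df with the difference
    tensor. *)
Lemma hessian_conf f y : A y ->
  hessian g' f y = hessian g f y + dtensor w f y + dtensor f w y
                   - gdot g f w y *: g y.
Proof.
move=> Ay; apply/matrixP => i j; rewrite gdot_conf_gradient.
have E := conf_christoffel_up (g y) (fun l => partial l w y) (conf_gradient y)
  (fun l => partial l f y) i j.
have hE : \sum_k christoffel g' k i j y * partial k f y =
    \sum_k christoffel g k i j y * partial k f y
    + \sum_k partial k f y * conf_christoffel (g y)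
        (fun l => partial l w y) (conf_gradient y) k i j.
  rewrite -big_split; apply: eq_bigr => k _.
  rewrite (christoffel_conf k i j Ay) mulrDl; congr (_ + _); exact: mulrC.
rewrite !mxE hE E; move: (\sum_k _) (\sum_k _) => a b.
move: (partial i (partial j f) y) (partial i w y) (partial j w y)
  (partial i f y) (partial j f y) (g y i j) => c wi wj fi fj gij.
by ring.
Qed.

Lemma gtrace_conf T y : A y -> gtrace g' T y = (s y)^-1 * gtrace g T y.
Proof.
move=> Ay; rewrite /gtrace conf_invmxE// mulr_sumr; apply: eq_bigr => i _.
by rewrite mulr_sumr; apply: eq_bigr => j _; rewrite mxE mulrA.
Qed.

End ConformalChange.
End LocalMetric.

(** * The conformal factor and its logarithm *)

Section LogarithmicFactor.
Variables (R : realType) (n : nat) (A : set 'rV[R]_n) (u : 'rV[R]_n -> R).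
Hypothesis A_open : open A.
Hypothesis u_smooth : smooth_on A u.
Hypothesis u_gt0 : forall y, A y -> 0 < u y.

Local Notation w := (fun y => ln (u y)).

Lemma partialV (f : 'rV[R]_n -> R) y i : f y != 0 ->
  derivable f y (delta_mx 0 i : 'rV[R]_n) ->
  partial i (fun z => (f z)^-1) y = - (f y) ^- 2 * partial i f y.
Proof. by move=> f0 df; exact: deriveV. Qed.

Lemma u_neq0 y : A y -> u y != 0.
Proof. by move=> /u_gt0 /lt0r_neq0. Qed.

Lemma pderivable_u : pderivable A u.
Proof. exact: smooth_on_pderivable. Qed.

Lemma pderivable_ln : pderivable A w.
Proof.
apply: (pderivable_comp (dh := fun t => t^-1)) pderivable_u => y Ay.
exact/is_derive1_ln/u_gt0.
Qed.

Lemma partial_ln y i : A y -> partial i w y = (u y)^-1 * partial i u y.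
Proof.
move=> Ay; apply: partial_comp; first exact/is_derive1_ln/u_gt0.
exact: pderivable_u.
Qed.

Lemma pderivable_partial_ln i : pderivable A (partial i w).
Proof.
apply: (pderivable_eq_on A_open (f := fun y => (u y)^-1 * partial i u y)).
  by move=> y Ay; rewrite partial_ln.
apply: pderivableM; last exact: smooth_on_pderivable_partial.
exact: (pderivableV u_neq0 pderivable_u).
Qed.

Lemma partial2_ln y i j : A y ->
  partial i (partial j w) y =
  (u y)^-1 * partial i (partial j u) y - partial i w y * partial j w y.
Proof.
move=> Ay.
rewrite (partial_eq_on A_open i Ay (fun z Az => @partial_ln z j Az)).
have du := @pderivable_u y Ay i.
have dv := @pderivableV _ _ _ _ u_neq0 pderivable_u y Ay i.
have ddu := @smooth_on_pderivable_partial _ _ _ u j u_smooth y Ay i.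
rewrite (partialM dv ddu) (partialV (u_neq0 Ay) du) !partial_ln//.
move: (partial i (partial j u) y) (partial i u y) (partial j u y) => a b c.
by have := u_neq0 Ay; move: (u y) => t t0; field.
Qed.

Lemma partial2_lnC y i j : A y ->
  partial i (partial j w) y = partial j (partial i w) y.
Proof.
move=> Ay; have E1 := partial2_ln i j Ay; have E2 := partial2_ln j i Ay.
have E3 := partial_commute A_open i j u_smooth Ay.
rewrite E1 [RHS]E2 E3.
exact: (congr1 (fun t => _ - t) (mulrC _ _)).
Qed.

Lemma hessian_ln g y : A y ->
  hessian g w y = (u y)^-1 *: hessian g u y - dtensor w w y.
Proof.
move=> Ay; apply/matrixP => i j; rewrite !mxE (partial2_ln i j Ay).
under eq_bigr do rewrite partial_ln// mulrCA.
rewrite -mulr_sumr mulrBr addrAC.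
by [].
Qed.

Lemma dtensor_lnr f y : A y ->
  dtensor f w y = (u y)^-1 *: dtensor f u y.
Proof.
by move=> Ay; apply/matrixP => i j; rewrite !mxE partial_ln// mulrCA.
Qed.

(** Verifies for the factor u^-2 the differential equation satisfied by s = e^{-2w}. *)
Lemma partial_sqrV y i : A y ->
  partial i (fun z => (u z) ^- 2) y = - 2 * (u y) ^- 2 * partial i w y.
Proof.
move=> Ay.
have du := @pderivable_u y Ay i.
have dv := @pderivableV _ _ _ _ u_neq0 pderivable_u y Ay i.
have -> : (fun z => (u z) ^- 2) = (fun z => (u z)^-1 * (u z)^-1).
  by apply/funext => z; rewrite -invfM -expr2.
rewrite (partialM dv dv) (partialV (u_neq0 Ay) du) partial_ln//.
move: (partial i u y) => a.
by have := u_neq0 Ay; move: (u y) => t t0; field.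
Qed.

Lemma pderivable_sqrV : pderivable A (fun z => (u z) ^- 2).
Proof.
have dv := @pderivableV _ _ _ _ u_neq0 pderivable_u.
apply: (pderivable_eq_on A_open (f := fun z => (u z)^-1 * (u z)^-1)).
  by move=> z _; rewrite -invfM -expr2.
exact: pderivableM.
Qed.

End LogarithmicFactor.

(** * Derivatives of a function equal to f + m h on an open set *)

Section HessianLinear.
Variables (R : realType) (n : nat) (A : set 'rV[R]_n).
Hypothesis A_open : open A.
Variables (f h : 'rV[R]_n -> R) (m : R).
Hypothesis f_der : pderivable A f.
Hypothesis h_der : pderivable A h.
Hypothesis f_der2 : forall i, pderivable A (partial i f).
Hypothesis h_der2 : forall i, pderivable A (partial i h).
Variable F : 'rV[R]_n -> R.
Hypothesis FE : forall y, A y -> F y = f y + m * h y.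

(** Serves both phi' = phi + m ln u and, with coefficient 1, phi' = phi + f for infinite dimensional
    parameter. *)
Lemma partial_lin y i : A y -> partial i F y = partial i f y + m * partial i h y.
Proof.
move=> Ay; rewrite (partial_eq_on A_open i Ay FE).
have dh : pderivable A (fun y => m * h y).
  exact: (pderivableM (@pderivable_cst _ _ A m) h_der).
by rewrite (partialD (@f_der y Ay i) (dh y Ay i)) (partialZ _ (@h_der y Ay i)).
Qed.

Lemma hessian_lin g y : A y -> hessian g F y = hessian g f y + m *: hessian g h y.
Proof.
move=> Ay; apply/matrixP => i j; rewrite !mxE.
rewrite (partial_eq_on A_open i Ay (fun z Az => @partial_lin z j Az)).
have dh : pderivable A (fun y => m * partial j h y).
  exact: (pderivableM (@pderivable_cst _ _ A m) (@h_der2 j)).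
rewrite (partialD (@f_der2 j y Ay i) (dh y Ay i)) (partialZ _ (@h_der2 j y Ay i)).
have -> : \sum_k christoffel g k i j y * partial k F y =
    \sum_k christoffel g k i j y * partial k f y
    + m * \sum_k christoffel g k i j y * partial k h y.
  rewrite mulr_sumr -big_split; apply: eq_bigr => k _.
  by rewrite (partial_lin k Ay) mulrDr; congr (_ + _); exact: mulrCA.
move: (\sum_k _) (\sum_k _) => a b.
move: (partial i (partial j f) y) (partial i (partial j h) y) => c d.
by ring.
Qed.

Lemma dtensor_linl k y : A y ->
  dtensor F k y = dtensor f k y + m *: dtensor h k y.
Proof.
by move=> Ay; apply/matrixP => i j; rewrite !mxE (partial_lin i Ay) mulrDl mulrA.
Qed.

Lemma dtensor_linr k y : A y ->
  dtensor k F y = dtensor k f y + m *: dtensor k h y.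
Proof.
by move=> Ay; apply/matrixP => i j; rewrite !mxE (partial_lin j Ay) mulrDr mulrCA.
Qed.

End HessianLinear.

(** * Weighted curvatures *)

Section Locality.
Variables (R : realType) (n : nat) (A : set 'rV[R]_n).
Hypothesis A_open : open A.
Variables g g' : 'rV[R]_n -> 'M[R]_n.
Hypothesis g'E : forall y, A y -> g' y = g y.

(** The components of the two metrics are compared only on the chart image, where openness lets
    their derivatives be identified too. *)
Lemma christoffel_local k i j y : A y ->
  christoffel g' k i j y = christoffel g k i j y.
Proof.
move=> Ay; rewrite /christoffel g'E//; congr (_ * _); apply: eq_bigr => l _.
have pE a b c : partial a (fun z => g' z b c) y = partial a (fun z => g z b c) y.
  by apply: (partial_eq_on A_open) => // z Az; rewrite g'E.
by rewrite !pE.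
Qed.

Lemma ricci_local y : A y -> ricci g' y = ricci g y.
Proof.
move=> Ay; apply/matrixP => k j; rewrite !mxE; apply: eq_bigr => i _.
have pE a b c d : partial a (christoffel g' b c d) y =
    partial a (christoffel g b c d) y.
  by apply: (partial_eq_on A_open) => // z Az; exact: christoffel_local.
rewrite /riemann !pE; congr (_ + _); apply: eq_bigr => p _.
by rewrite !christoffel_local.
Qed.

Lemma hessian_local f y : A y -> hessian g' f y = hessian g f y.
Proof.
move=> Ay; apply/matrixP => i j; rewrite !mxE; congr (_ - _).
by apply: eq_bigr => k _; rewrite christoffel_local.
Qed.

Lemma gtrace_local T y : A y -> gtrace g' T y = gtrace g T y.
Proof. by move=> Ay; rewrite /gtrace g'E. Qed.

End Locality.

(* Here v = 1/u, mi = 1/m, w = ln u, p = <grad phi, grad w> and q = |grad w|^2. *)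
Lemma wricci_algebra (R : realType) (n : nat)
    (Ric Hp Hu Tpp Tpw Twp Tww G : 'M[R]_n) (m mi N v Lu p q : R) :
  (mi * m) *: Tpw = Tpw -> (mi * m) *: Twp = Twp -> mi * m * m = m ->
  Ric + (N - 2) *: (v *: Hu - Tww + Tww) + (v * Lu - q - (N - 2) * q) *: G
  + (Hp + m *: (v *: Hu - Tww) + (Twp + m *: Tww) + (Tpw + m *: Tww)
     - (p + m * q) *: G)
  - mi *: (Tpp + m *: Twp + m *: (Tpw + m *: Tww)) =
  Ric + Hp - mi *: Tpp + ((m + N - 2) * v) *: Hu
  + (v * Lu - p - (m + N - 1) * q) *: G.
Proof.
move=> /matrixP e1 /matrixP e2 e3; apply/matrixP => i j.
move: (e1 i j) (e2 i j); rewrite !mxE => {}e1 {}e2.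
(* Up to the three last summands the identity is polynomial; these are the residues that the
   hypotheses on [mi * m] make vanish. *)
transitivity (Ric i j + Hp i j - mi * Tpp i j + (m + N - 2) * v * Hu i j
  + (v * Lu - p - (m + N - 1) * q) * G i j
  + (Tpw i j - mi * m * Tpw i j) + (Twp i j - mi * m * Twp i j)
  + (m - mi * m * m) * Tww i j); first by ring.
by rewrite e1 e2 e3 !subrr mul0r !addr0.
Qed.

(** The traced counterpart, with Lp the Laplacian of phi, Tpp = |grad phi|^2 and N the trace of g.
    The coefficient 1 + 1/m of the gradient term differs from the tensor case, so it is a separate
    identity. *)
Lemma wscalar_algebra (R : realType) (Ric Lp Tpp m mi N v Lu p q : R) :
  mi * m * p = p -> mi * m * m = m ->
  Ric + (N - 2) * (v * Lu - q + q) + (v * Lu - q - (N - 2) * q) * N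
  + 2 * (Lp + m * (v * Lu - q) + (p + m * q) + (p + m * q) - (p + m * q) * N)
  - (1 + mi) * (Tpp + m * p + m * (p + m * q)) =
  Ric + 2 * Lp - (1 + mi) * Tpp + 2 * (m + N - 1) * (v * Lu - p)
  - (m + N) * (m + N - 1) * q.
Proof.
move=> e1 e2.
transitivity (Ric + 2 * Lp - (1 + mi) * Tpp + 2 * (m + N - 1) * (v * Lu - p)
  - (m + N) * (m + N - 1) * q + 2 * (p - mi * m * p) + (m - mi * m * m) * q).
  by ring.
by rewrite e1 e2 !subrr mulr0 mul0r !addr0.
Qed.

(** * Weighted Ricci and scalar curvature of the conformal space in a chart *)

Section WeightedConformal.
Variables (R : realType) (n : nat) (A : set 'rV[R]_n).
Hypothesis A_open : open A.
Variables (g g' : 'rV[R]_n -> 'M[R]_n) (f f' u : 'rV[R]_n -> R) (m : R).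
Hypothesis g_der : forall i j, pderivable A (fun y => g y i j).
Hypothesis g_der2 :
  forall k i j, pderivable A (partial k (fun y => g y i j)).
Hypothesis g_sym : forall y, A y -> (g y)^T = g y.
Hypothesis g_unit : forall y, A y -> g y \in unitmx.
Hypothesis u_smooth : smooth_on A u.
Hypothesis u_gt0 : forall y, A y -> 0 < u y.
Hypothesis f_smooth : smooth_on A f.
Hypothesis f0 : m = 0 -> forall y, A y -> f y = 0.
Hypothesis g'E : forall y, A y -> g' y = (u y) ^- 2 *: g y.
Hypothesis f'E : forall y, A y -> f' y = f y + m * ln (u y).

Local Notation w := (fun y => ln (u y)).

Variable x : 'rV[R]_n.
Hypothesis Ax : A x.

Let f_der : pderivable A f. Proof. exact: smooth_on_pderivable. Qed.

Let f_der2 i : pderivable A (partial i f).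
Proof. exact: smooth_on_pderivable_partial. Qed.

Let w_der := pderivable_ln u_smooth u_gt0.

Let w_der2 := pderivable_partial_ln A_open u_smooth u_gt0.

Let u2_neq0 y : A y -> (u y) ^- 2 != 0.
Proof. by move=> Ay; rewrite invr_eq0 expf_neq0// (u_neq0 u_gt0). Qed.

Let ricciE := ricci_conf A_open g_der g_sym g_unit g_der2 w_der2
  (partial2_lnC A_open u_smooth u_gt0) u2_neq0
  (pderivable_sqrV A_open u_smooth u_gt0)
  (partial_sqrV u_smooth u_gt0) g'E Ax.

Let hessE := hessian_conf A_open g_der g_sym g_unit u2_neq0
  (pderivable_sqrV A_open u_smooth u_gt0)
  (partial_sqrV u_smooth u_gt0) g'E f' Ax.

(** Both sides vanish at a = 0, so the m^2 terms simplify uniformly in m. *)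
Lemma inv_mulK (a : R) : a^-1 * a * a = a.
Proof. by have [->|a0] := eqVneq a 0; rewrite ?mulr0// mulVf// mul1r. Qed.

(* For m = 0 the junk value 0^-1 = 0 is harmless because f vanishes. *)
Lemma dtensor_absorb h : m^-1 * m *: dtensor f h x = dtensor f h x /\
  m^-1 * m *: dtensor h f x = dtensor h f x.
Proof.
have [m0|m0] := eqVneq m 0; last by rewrite mulVf// !scale1r.
have df i : partial i f x = 0.
  by rewrite (partial_eq_on A_open i Ax (f0 m0)) partial_cst.
split; apply/matrixP => i j; rewrite !mxE df.
  by rewrite mul0r mulr0.
by rewrite !mulr0.
Qed.

Let gdot_wE h : gdot g h w x = (u x)^-1 * gdot g h u x.
Proof. by rewrite /gdot (dtensor_lnr u_smooth u_gt0 _ Ax) gtraceZ. Qed.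

Let gdot_wwE : gdot g w w x = (u x) ^- 2 * gdot g u u x.
Proof.
by rewrite gdot_wE (gdotC g_sym _ _ Ax) gdot_wE mulrA -invfM -expr2.
Qed.

Let laplacian_wE : laplacian g w x = (u x)^-1 * laplacian g u x - gdot g w w x.
Proof.
rewrite /laplacian (hessian_ln A_open u_smooth u_gt0 g Ax).
by rewrite gtraceD gtraceN gtraceZ.
Qed.

Let hessian_f'E := hessian_lin A_open f_der w_der f_der2 w_der2 f'E g Ax.

Let dtensor_f'lE h := dtensor_linl A_open f_der w_der f'E h Ax.

Let dtensor_f'rE h := dtensor_linr A_open f_der w_der f'E h Ax.

Let gdot_f'wE : gdot g f' w x = gdot g f w x + m * gdot g w w x.
Proof. by rewrite /gdot dtensor_f'lE gtraceD gtraceZ. Qed.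

Lemma wricci_conf :
  ricci g' x + hessian g' f' x - m^-1 *: dtensor f' f' x =
  ricci g x + hessian g f x - m^-1 *: dtensor f f x
  + ((m + n%:R - 2) * (u x)^-1) *: hessian g u x
  + ((u x)^-1 * (laplacian g u x - gdot g f u x)
     - (m + n%:R - 1) * (u x) ^- 2 * gdot g u u x) *: g x.
Proof.
have [efw ewf] := dtensor_absorb w.
rewrite ricciE hessE hessian_f'E gdot_f'wE !dtensor_f'rE !dtensor_f'lE.
rewrite laplacian_wE (hessian_ln A_open u_smooth u_gt0 g Ax).
have := @wricci_algebra R n (ricci g x) (hessian g f x) (hessian g u x)
  (dtensor f f x) (dtensor f w x) (dtensor w f x) (dtensor w w x) (g x)
  m m^-1 n%:R (u x)^-1 (laplacian g u x) (gdot g f w x) (gdot g w w x)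
  efw ewf (inv_mulK m).
rewrite [in RHS]gdot_wwE [in RHS]gdot_wE.
by move=> ->; rewrite mulrBr mulrA.
Qed.

(** The trace with respect to u^-2 g is u^2 times the trace with respect to g, which accounts for
    the outer factor; tracing the multiples of g produces n. *)
Lemma wscalar_conf :
  scalar_curv g' x + 2 * laplacian g' f' x - (1 + m^-1) * gdot g' f' f' x =
  (u x) ^+ 2 *
  (scalar_curv g x + 2 * laplacian g f x - (1 + m^-1) * gdot g f f x
   + 2 * (m + n%:R - 1) * (u x)^-1 * (laplacian g u x - gdot g f u x)
   - (m + n%:R) * (m + n%:R - 1) * (u x) ^- 2 * gdot g u u x).
Proof.
have efw : m^-1 * m * gdot g f w x = gdot g f w x.
  by rewrite -gtraceZ (dtensor_absorb w).1.
have wfE : gtrace g (dtensor w f x) x = gdot g f w x.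
  exact: (gdotC g_sym w f Ax).
have gtE T := gtrace_conf g_unit u2_neq0 g'E T Ax.
rewrite /scalar_curv [laplacian g' _ _]/laplacian [gdot g' _ _ _]/gdot !gtE.
rewrite ricciE hessE hessian_f'E gdot_f'wE !dtensor_f'rE !dtensor_f'lE.
rewrite !(gtraceD, gtraceN, gtraceZ) wfE (gtrace_metric g_sym g_unit Ax).
rewrite -!/(gdot g _ _ x) -!/(laplacian g _ x) laplacian_wE invrK.
have W := @wscalar_algebra R (gtrace g (ricci g x) x) (laplacian g f x)
  (gdot g f f x) m m^-1 n%:R (u x)^-1 (laplacian g u x) (gdot g f w x)
  (gdot g w w x) efw (inv_mulK m).
(* Every geometric quantity becomes a variable, so that after passing from w to u only algebra
   remains. *)
move: W (gdot_wE f) gdot_wwE; clear.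
move: (gtrace g (ricci g x) x) (laplacian g f x) (gdot g f f x) (gdot g f w x)
  (gdot g w w x) (laplacian g u x) (gdot g f u x) (gdot g u u x) m^-1 (n%:R : R)
  (u x) => Rc Lf ff fw ww Lu fu uu mi N t W wE wwE.
rewrite wE wwE in W *.
transitivity (t ^+ 2 * (Rc + 2 * Lf - (1 + mi) * ff
  + 2 * (m + N - 1) * (t^-1 * Lu - t^-1 * fu)
  - (m + N) * (m + N - 1) * (t ^- 2 * uu))); last by ring.
by rewrite -W; ring.
Qed.

End WeightedConformal.

(** * The metric, the measure and phi read in a chart *)

Section MetricInChart.
Variables (R : realType) (n : nat) (M : manifold R n) (S : smms M).
Variable c : atlas_index M.

(** A nonzero vector in the kernel would contradict positive definiteness. *)
Lemma scomp_unitmx y : ccod (atlas c) y -> scomp S c y \in unitmx.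
Proof.
move=> cy; rewrite unitmxE unitfE; apply/negP => /det0P[v v0 vg].
by have := gcomp_posdef (metric S) cy v0; rewrite -/(scomp S c y) vg mul0mx mxE ltxx.
Qed.

Lemma scomp_der i j : pderivable (ccod (atlas c)) (fun y => scomp S c y i j).
Proof. exact: smooth_on_pderivable (gcomp_smooth (metric S) c i j). Qed.

Lemma scomp_der2 k i j :
  pderivable (ccod (atlas c)) (partial k (fun y => scomp S c y i j)).
Proof.
exact: (@smooth_on_pderivable_partial _ _ _ _ k (gcomp_smooth (metric S) c i j)).
Qed.

Lemma sqrt_det_gt0 y : ccod (atlas c) y -> 0 < Num.sqrt `|\det (scomp S c y)|.
Proof.
move=> cy; rewrite sqrtr_gt0 normr_gt0 -unitfE -unitmxE.
exact: scomp_unitmx.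
Qed.

End MetricInChart.

Lemma sqrt_det_conf (R : realType) (n : nat) (g : 'M[R]_n) (t : R) : 0 < t ->
  Num.sqrt `|\det (t ^- 2 *: g)| = t ^- n * Num.sqrt `|\det g|.
Proof.
move=> t0; rewrite detZ normrM sqrtrM//; congr (_ * _).
rewrite -exprVn -exprM mulnC exprM exprVn.
by rewrite ger0_norm ?sqr_ge0// sqrtr_sqr ger0_norm// invr_ge0 exprn_ge0// ltW.
Qed.

(** Cancelling the positive density sqrt(det g) leaves u^-n e^{-phi'} = u^{-m-n} e^{-phi}, and
    taking logarithms gives phi'. *)
Lemma conformal_phi (R : realType) (n : nat) (M : manifold R n) (S S' : smms M)
    (m : R) (u : M -> R) (c : atlas_index M) (y : 'rV[R]_n) :
  (forall p, 0 < u p) -> conformal m u S S' -> ccod (atlas c) y ->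
  phi_in S' c y = phi_in S c y + m * ln (in_chart c u y).
Proof.
move=> u0 [_ _ /(_ c y) + cy] => /(_ cy)[gE]; rewrite /weighted_density gE.
have t0 : 0 < in_chart c u y by exact: u0.
move: (in_chart c u y) t0 => t t0.
rewrite sqrt_det_conf// !mulrA => /(mulIf (lt0r_neq0 (sqrt_det_gt0 S cy))).
(* All powers of u are written as exponentials, so that injectivity of exp yields a linear
   equation. *)
have tN : t ^- n = expR (- (n%:R * ln t)).
  by rewrite expRN expRM_natl lnK// posrE.
rewrite tN /powR (negPf (lt0r_neq0 t0)) -!expRD => /expR_inj.
rewrite /phi_in; move: (in_chart c (phi S) y) (in_chart c (phi S') y) => a b.
by move: (ln t) (n%:R : R) => l N; lra.
Qed.

(** The metrics agree, so the densities cancel at once. The coefficient 1 matches the form f + m h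
    of the linearity lemmas. *)
Lemma conformal_inf_phi (R : realType) (n : nat) (M : manifold R n)
    (S S' : smms M) (f : M -> R) (c : atlas_index M) (y : 'rV[R]_n) :
  conformal_inf f S S' -> ccod (atlas c) y ->
  phi_in S' c y = phi_in S c y + 1 * in_chart c f y.
Proof.
move=> [_ _ /(_ c y) + cy] => /(_ cy)[gE]; rewrite /weighted_density gE mulrA.
move=> /(mulIf (lt0r_neq0 (sqrt_det_gt0 S cy))).
rewrite -expRD => /expR_inj.
rewrite /phi_in; move: (in_chart c (phi S) y) (in_chart c (phi S') y) => a b.
by move: (in_chart c f y) => t; lra.
Qed.

(** For m = 0 the relation v^m = e^{-phi} reads 1 = e^{-phi}. *)
Lemma phi_in_eq0 (R : realType) (n : nat) (M : manifold R n) (S : smms M)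
    (c : atlas_index M) (y : 'rV[R]_n) : dimpar S = 0%:E -> phi_in S c y = 0.
Proof.
move=> S0; have := vfun_phi S0 (cinv (atlas c) y).
rewrite powRr0 -[1]expR0 => /expR_inj/esym/eqP.
by rewrite oppr_eq0 => /eqP.
Qed.

(** * Transformation formulas for finite and infinite dimensional parameter *)

Theorem proposition4p4 (R : realType) (n : nat) (M : manifold R n)
    (S S' : smms M) :
  (forall (m : R) (u : M -> R),
     smooth_fun u -> (forall p, 0 < u p) -> conformal m u S S' ->
     forall (c : atlas_index M) (x : 'rV[R]_n), ccod (atlas c) x ->
     let ux := in_chart c u x in
     wricci S' c x =
       wricci S c x
       + ((m + n%:R - 2) * ux^-1) *: hess S u c x
       + (ux^-1 * wlaplacian S u c x
          - (m + n%:R - 1) * ux ^- 2 * sqnorm_grad S u c x) *: scomp S c x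
     /\
     wscalar S' c x =
       ux ^+ 2 *
       (wscalar S c x
        + 2 * (m + n%:R - 1) * ux^-1 * wlaplacian S u c x
        - (m + n%:R) * (m + n%:R - 1) * ux ^- 2 * sqnorm_grad S u c x))
  /\
  (forall f : M -> R,
     smooth_fun f -> conformal_inf f S S' ->
     forall (c : atlas_index M) (x : 'rV[R]_n), ccod (atlas c) x ->
     wricci S' c x = wricci S c x + hess S f c x
     /\
     wscalar S' c x =
       wscalar S c x + 2 * wlaplacian S f c x - sqnorm_grad S f c x).
Proof.
split=> [m u u_smooth u0 conf c x cx ux|f f_smooth conf c x cx].
  have [Sm S'm gE] := conf.
  have phi0 : m = 0 -> forall y, ccod (atlas c) y -> phi_in S c y = 0.
    by move=> m0 y _; apply: phi_in_eq0; rewrite Sm m0.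
  have g'E y : ccod (atlas c) y -> scomp S' c y = in_chart c u y ^- 2 *: scomp S c y.
    by move=> /(gE c y) [].
  have phiE y := @conformal_phi R n M S S' m u c y u0 conf.
  have A_open : open (ccod (atlas c)) by exact: ccod_open.
  have t0 y : ccod (atlas c) y -> 0 < in_chart c u y by move=> _; exact: u0.
  have gs y := @gcomp_sym _ _ _ (metric S) c y.
  have di : dim_inv S = m^-1 by rewrite /dim_inv Sm.
  have di' : dim_inv S' = m^-1 by rewrite /dim_inv S'm.
  split.
    rewrite /wricci di di'.
    exact: (wricci_conf A_open (@scomp_der _ _ _ S c) (@scomp_der2 _ _ _ S c) gs
      (@scomp_unitmx _ _ _ S c) (u_smooth c) t0 (phi_smooth S c) phi0 g'E phiE cx).
  rewrite /wscalar di di'.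
  exact: (wscalar_conf A_open (@scomp_der _ _ _ S c) (@scomp_der2 _ _ _ S c) gs
    (@scomp_unitmx _ _ _ S c) (u_smooth c) t0 (phi_smooth S c) phi0 g'E phiE cx).
(* For infinite m the metric is unchanged and 1/m is read as 0, so only the replacement of phi by
   phi + f matters. *)
have [Soo S'S gE] := conf.
have di : dim_inv S = 0 by rewrite /dim_inv; case: Soo => ->.
have di' : dim_inv S' = 0 by rewrite /dim_inv S'S; case: Soo => ->.
have A_open : open (ccod (atlas c)) by exact: ccod_open.
have g'E y : ccod (atlas c) y -> scomp S' c y = scomp S c y.
  by move=> /(gE c y) [].
have gs y := @gcomp_sym _ _ _ (metric S) c y.
have phiE y := @conformal_inf_phi R n M S S' f c y conf.
have fD := smooth_on_pderivable (f_smooth c).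
have pD := smooth_on_pderivable (phi_smooth S c).
have fD2 i := @smooth_on_pderivable_partial _ _ _ _ i (f_smooth c).
have pD2 i := @smooth_on_pderivable_partial _ _ _ _ i (phi_smooth S c).
have hE : hessian (scomp S' c) (phi_in S' c) x =
    hessian (scomp S c) (phi_in S c) x + hess S f c x.
  rewrite (hessian_local A_open g'E _ cx).
  by rewrite (hessian_lin A_open pD fD pD2 fD2 phiE _ cx) scale1r.
have rE := ricci_local A_open g'E cx.
split.
  by rewrite /wricci di di' !scale0r !subr0 rE hE addrA.
rewrite /wscalar di di' !addr0 !mul1r /wlaplacian /sqnorm_grad.
rewrite /scalar_curv /laplacian hE rE.
(* Symmetry of the metric merges the mixed terms into 2 <grad phi, grad f>, which is what turns
   twice the Laplacian of f into twice its weighted Laplacian. *)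
have dE : gdot (scomp S' c) (phi_in S' c) (phi_in S' c) x =
    gdot (scomp S c) (phi_in S c) (phi_in S c) x
    + 2 * gdot (scomp S c) (phi_in S c) (in_chart c f) x
    + gdot (scomp S c) (in_chart c f) (in_chart c f) x.
  rewrite /gdot (gtrace_local g'E _ cx).
  rewrite (dtensor_linl A_open pD fD phiE _ cx) !scale1r.
  rewrite !(dtensor_linr A_open pD fD phiE _ cx) !scale1r !gtraceD.
  rewrite -!/(gdot _ _ _ x) (gdotC gs (in_chart c f) _ cx).
  move: (gdot _ _ _ x) (gdot _ _ _ x) (gdot _ _ _ x) => p q r.
  by ring.
rewrite dE !(gtrace_local g'E _ cx) gtraceD.
rewrite -!/(laplacian _ _ x).
move: (gtrace _ _ _) (laplacian _ _ _) (laplacian _ _ _) (gdot _ _ _ x)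
  (gdot _ _ _ x) (gdot _ _ _ x) => a b d p q r.
by ring.
Qed.
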